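(* Suppose that $$f(\mathbf x,\mathbf y)=a_{11}x_1^2y_1^2+a_{22}x_2^2y_2^2+a_{12}x_1^2y_2^2+a_{21}x_2^2y_1^2-b\,x_1y_1x_2y_2-c_{y1}x_1x_2y_1^2.$$ Let $$g(a_{112})=\sqrt{(a_{11}-a_{112})a_{22}}+\sqrt{a_{12}\Bigl(a_{21}-\frac{c_{y1}^2}{4a_{112}}\Bigr)},$$ and let $a_{112}^*\in\bigl(\frac{c_{y1}^2}{4a_{21}},a_{11}\bigr)$ be the unique parameter such that the derivative $g'(a_{112}^* )=0$. Then the following three statements are equivalent: (a) $f(\mathbf x,\mathbf y)$ is PSD. (b) $f(\mathbf x,\mathbf y)$ is SOS. (c) It holds that $g(a_{112}^* )\ge\frac{|b|}{2}$.
   Context: Here $\mathbf x=(x_1,x_2)^\top$ and $\mathbf y=(y_1,y_2)^\top$ are real variables, and $a_{11},a_{12},a_{21},a_{22},b,c_{y1}$ are real coefficients. The function $g$ is a function of the single real variable $a_{112}$, and $g'$ is its derivative with respect to $a_{112}$. A real polynomial is PSD (positive semi-definite) if it takes nonnegative values at all real points; it is SOS (sum of squares) if it is a finite sum of squares of real polynomials.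
   Formalization: The formal theorem adds the assumption a_21 > 0; without it the claim fails, e.g. a_11 = a_21 = -1, a_12 = a_22 = 1, c_y1 = 4, b = 0, where a_112* = -2 and g = 2 ≥ |b|/2 but f is not PSD. *)

(* Defs.v *)
From mathcomp Require Import all_boot all_order all_algebra.
From mathcomp Require Import reals topology normedtype derive.
(* The notations of [mpoly] clash with those of mathcomp-analysis. *)
From mathcomp Require Import -(notations) mpoly.

Set Implicit Arguments.
Unset Strict Implicit.
Unset Printing Implicit Defensive.

Import Order.TTheory GRing.Theory Num.Theory.
Import numFieldNormedType.Exports.

Local Open Scope ring_scope.

Definition psd (R : realType) (n : nat) (p : mpoly n R) : Prop :=
  forall v : 'I_n -> R, 0 <= meval v p.

Definition sos (R : realType) (n : nat) (p : mpoly n R) : Prop :=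
  exists s : seq (mpoly n R), p = \sum_(q <- s) q ^+ 2.

Definition mvar (R : realType) (n : nat) (i : 'I_n) : mpoly n R :=
  mpolyX R (mnm1 i).

(* The indeterminates 0, 1, 2, 3 stand for x_1, x_2, y_1, y_2. *)
Definition biquad (R : realType) (a11 a12 a21 a22 b cy1 : R) :
    mpoly 4 R :=
  let x1 := mvar R (inord 0 : 'I_4) in
  let x2 := mvar R (inord 1 : 'I_4) in
  let y1 := mvar R (inord 2 : 'I_4) in
  let y2 := mvar R (inord 3 : 'I_4) in
  a11 *: (x1 ^+ 2 * y1 ^+ 2) + a22 *: (x2 ^+ 2 * y2 ^+ 2)
  + a12 *: (x1 ^+ 2 * y2 ^+ 2) + a21 *: (x2 ^+ 2 * y1 ^+ 2)
  - b *: (x1 * y1 * x2 * y2) - cy1 *: (x1 * x2 * y1 ^+ 2).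

Definition gfun (R : realType) (a11 a12 a21 a22 cy1 a112 : R) : R :=
  Num.sqrt ((a11 - a112) * a22)
  + Num.sqrt (a12 * (a21 - cy1 ^+ 2 / (4 * a112))).

(* [is_derive] asserts differentiability as well as the value of g', so points
   where g is not differentiable do not count as critical. *)
Definition critical_param (R : realType) (a11 a12 a21 a22 cy1 t : R) : Prop :=
  cy1 ^+ 2 / (4 * a21) < t < a11 /\
  is_derive t (1 : R) (gfun a11 a12 a21 a22 cy1) (0 : R).

(* Main.v *)
(* With u, v the two square roots in g(t), split b = beta u + beta v, where
   beta = b / (u + v), and split a11 = (a11 - t) + t. If |beta| <= 2, then
   f is the sum of two PSD binary forms, one in (x1 y1, x2 y2) and one in
   (x1 y2, x2 y1), and of the square t (x1 - c/(2t) x2)^2 y1^2.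
   At the critical t, where 4 t^2 a22 v = a12 c^2 u, the squares coming from
   |beta| = 2 have a common nonzero real zero, so f takes a positive multiple
   of 2 g(t) - |b| there, whence (a) -> (c). Existence and uniqueness of the
   critical parameter force a12, a22 > 0 (and c <> 0). *)
Require Import Defs.
From mathcomp Require Import all_boot all_order all_algebra.
From mathcomp Require Import ring lra.
From mathcomp Require Import boolp functions reals topology normedtype derive realfun.
From mathcomp Require Import -(notations) mpoly.

Set Implicit Arguments.
Unset Strict Implicit.
Unset Printing Implicit Defensive.

Import Order.TTheory GRing.Theory Num.Theory.
Import numFieldNormedType.Exports.
Local Open Scope ring_scope.

(** * Sums of squares and binary quadratic forms *)

Lemma sos_psd (R : realType) n (p : mpoly n R) : sos p -> psd p.
Proof.
move=> [s ->] v; rewrite raddf_sum sumr_ge0 // => q _.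
by rewrite expr2 /= mevalM -expr2 sqr_ge0.
Qed.

Lemma sosD (R : realType) n (p q : mpoly n R) : sos p -> sos q -> sos (p + q).
Proof. by move=> [s ->] [t ->]; exists (s ++ t); rewrite big_cat. Qed.

Lemma sosZ_sqr (R : realType) n (k : R) (p : mpoly n R) :
  0 <= k -> sos (k *: p ^+ 2).
Proof.
move=> k0; exists [:: Num.sqrt k *: p].
by rewrite big_seq1 exprZn sqr_sqrtr.
Qed.

(** Completing the square in [p] leaves [q ^+ 2] with coefficient [l - m ^+ 2 / (4 * k)], which the
    discriminant bound makes nonnegative. *)
Lemma sos_binary_form (R : realType) n (k l m : R) (p q : mpoly n R) :
  0 < k -> m ^+ 2 <= 4 * k * l -> sos (k *: p ^+ 2 + l *: q ^+ 2 - m *: (p * q)).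
Proof.
move=> k0 disc.
have -> : k *: p ^+ 2 + l *: q ^+ 2 - m *: (p * q) =
    k *: (p - (m / (2 * k)) *: q) ^+ 2 + (l - m ^+ 2 / (4 * k)) *: q ^+ 2.
  (* Polynomials have no division by [k], so [m] is written as [2 * (k * c)] with [c = m / (2 * k)];
     the identity then holds in any commutative ring. *)
  have kc : k * (m / (2 * k)) = m / 2 by field; lra.
  have -> : m ^+ 2 / (4 * k) = k * (m / (2 * k)) ^+ 2 by field; lra.
  have -> : m = 2 * (k * (m / (2 * k))) by rewrite kc; field.
  set c := m / (2 * k) in kc *.
  have -> : 2 * (k * c) / (2 * k) = c by field; lra.
  rewrite -!mul_mpolyC !expr2 !(mpolyCB, mpolyCM, mpolyC_nat).
  by ring.
apply: sosD; apply: sosZ_sqr; first exact: ltW.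
by rewrite subr_ge0 ler_pdivrMr ?mulr_gt0 // mulrC.
Qed.

Lemma meval_biquad (R : realType) (a11 a12 a21 a22 b cy1 x1 x2 y1 y2 : R) :
  meval (fun i : 'I_4 => nth 0 [:: x1; x2; y1; y2] i)
    (biquad a11 a12 a21 a22 b cy1) =
  a11 * (x1 ^+ 2 * y1 ^+ 2) + a22 * (x2 ^+ 2 * y2 ^+ 2)
  + a12 * (x1 ^+ 2 * y2 ^+ 2) + a21 * (x2 ^+ 2 * y1 ^+ 2)
  - b * (x1 * y1 * x2 * y2) - cy1 * (x1 * x2 * y1 ^+ 2).
Proof.
by rewrite /biquad /mvar !(mevalB, mevalD, mevalZ, expr2, mevalM, mevalXU) !inordK.
Qed.

(** * The derivative of g and the critical equation *)

(** Near [t], where [f] stays positive, [Num.sqrt k] factors out for [k] of any sign. So g can be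
    differentiated before the signs of [a12] and [a22] are known. *)
Lemma is_derive_sqrtM (R : realType) (k : R) (f : R -> R) (t df : R) :
  0 < f t -> is_derive t (1 : R) f df ->
  is_derive t (1 : R) (fun x => Num.sqrt (f x * k))
    (df / (2 * Num.sqrt (f t)) * Num.sqrt k).
Proof.
move=> ft fdf.
have cf : {for t, continuous f}.
  by apply/differentiable_continuous/derivable1_diffP; case: fdf.
apply: (@near_eq_is_derive _ _ _ (fun x => Num.sqrt k * Num.sqrt (f x))).
  have fgt : \forall x \near t, 0 < f x by exact: cvgr_gt cf _ ft.
  by near=> x; rewrite sqrtrM 1?mulrC // ltW //; near: x.
have sd := is_derive1_sqrt ft.
have := is_deriveZ (Num.sqrt k) (is_derive1_comp sd fdf).
move=> h; apply: is_derive_eq h _ => /=.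
rewrite /GRing.scale /=; ring.
Unshelve. all: by end_near. Qed.

Lemma slack_gt0 (R : realFieldType) (a21 c t : R) :
  0 < a21 -> c ^+ 2 / (4 * a21) < t -> 0 < t /\ 0 < a21 - c ^+ 2 / (4 * t).
Proof.
move=> a21_gt0 ct.
have t_gt0 : 0 < t.
  by apply: le_lt_trans ct; rewrite divr_ge0 ?sqr_ge0 // mulr_ge0 // ltW.
split=> //; move: ct; rewrite subr_gt0 !ltr_pdivrMr ?mulr_gt0 //.
by rewrite mulrCA [in X in _ -> X]mulrCA [t * _]mulrC.
Qed.

Lemma is_derive_gfun (R : realType) (a11 a12 a21 a22 c t : R) :
  0 < a21 -> c ^+ 2 / (4 * a21) < t < a11 ->
  is_derive t (1 : R) (gfun a11 a12 a21 a22 c)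
    (- 1 / (2 * Num.sqrt (a11 - t)) * Num.sqrt a22
     + c ^+ 2 / (4 * t ^+ 2) / (2 * Num.sqrt (a21 - c ^+ 2 / (4 * t)))
       * Num.sqrt a12).
Proof.
move=> a21_gt0 /andP[ct ta].
have [t_gt0 s_gt0] := slack_gt0 a21_gt0 ct.
have df : is_derive t (1 : R) (fun x : R => a11 - x) (- 1).
  have := is_deriveB (is_derive_cst a11 t (1 : R)) (is_derive_id t (1 : R)).
  by move=> h; apply: is_derive_eq h _; rewrite sub0r.
have t0 : t != 0 by rewrite gt_eqF.
have dh : is_derive t (1 : R) (fun x : R => a21 - c ^+ 2 / (4 * x))
    (c ^+ 2 / (4 * t ^+ 2)).
  have tV := is_deriveV t0 (is_derive_id t (1 : R)).
  have h := is_deriveB (is_derive_cst a21 t 1) (is_deriveZ (c ^+ 2 / 4) tV).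
  have -> : (fun x : R => a21 - c ^+ 2 / (4 * x)) =
      cst a21 - (c ^+ 2 / 4) \*: (fun x : R => x^-1).
    by apply/funext => x; rewrite !fctE /= invfM mulrA.
  by apply: is_derive_eq h _; rewrite /GRing.scale /=; field.
have -> : gfun a11 a12 a21 a22 c = (fun x => Num.sqrt ((a11 - x) * a22)) +
    (fun x => Num.sqrt ((a21 - c ^+ 2 / (4 * x)) * a12)).
  by apply/funext => x; rewrite /gfun !fctE /= [a12 * _]mulrC.
by apply: is_deriveD; apply: is_derive_sqrtM => //; rewrite subr_gt0.
Qed.

(** Multiplying g'(t) by the positive number [8 * t ^+ 2 * u * v] clears its denominators and gives
    the right side minus the left side. *)
Lemma critical_paramE (R : realType) (a11 a12 a21 a22 c t : R) :
  0 < a21 -> c ^+ 2 / (4 * a21) < t < a11 ->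
  critical_param a11 a12 a21 a22 c t <->
  4 * t ^+ 2 * Num.sqrt a22 * Num.sqrt (a21 - c ^+ 2 / (4 * t)) =
  c ^+ 2 * Num.sqrt a12 * Num.sqrt (a11 - t).
Proof.
move=> a21_gt0 ctc; have dg := is_derive_gfun a12 a22 a21_gt0 ctc.
have /andP[ct ta] := ctc; have [t_gt0 s_gt0] := slack_gt0 a21_gt0 ct.
have u_gt0 : 0 < Num.sqrt (a11 - t) by rewrite sqrtr_gt0 subr_gt0.
have v_gt0 : 0 < Num.sqrt (a21 - c ^+ 2 / (4 * t)) by rewrite sqrtr_gt0.
move: dg; set u := Num.sqrt (a11 - t) in u_gt0 *.
set v := Num.sqrt _ in v_gt0 *; set d := (X in is_derive _ _ _ X) => dg.
have dE : 8 * t ^+ 2 * u * v * d =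
    c ^+ 2 * Num.sqrt a12 * u - 4 * t ^+ 2 * Num.sqrt a22 * v.
  rewrite /d; field.
  by rewrite !gt_eqF.
have w_gt0 : 0 < 8 * t ^+ 2 * u * v by rewrite !mulr_gt0 ?exprn_gt0.
split=> [[_ [_ d0]]|E].
  case: dg => _; rewrite d0 => d0'; move: dE; rewrite -d0' mulr0.
  by move/esym/subr0_eq.
split=> //; apply: is_derive_eq dg _; apply/eqP.
by rewrite -(mulrI_eq0 _ (lregP (lt0r_neq0 w_gt0))) dE E subrr.
Qed.

Lemma unique_critical_gt0 (R : realType) (a11 a12 a21 a22 c t : R) :
  0 < a21 -> unique (critical_param a11 a12 a21 a22 c) t ->
  0 < a12 /\ 0 < a22.
Proof.
move=> a21_gt0 [crit uniq_t]; have [ctc _] := crit; have /andP[ct ta] := ctc.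
have [t_gt0 s_gt0] := slack_gt0 a21_gt0 ct.
have := (critical_paramE a12 a22 a21_gt0 ctc).1 crit.
have [a22_le0|a22_gt0] := leP a22 0; last first.
  have [a12_le0|//] := leP a12 0.
  rewrite (ler0_sqrtr a12_le0) mulr0 mul0r => /eqP.
  by rewrite gt_eqF // !mulr_gt0 ?exprn_gt0 ?sqrtr_gt0.
(* Num.sqrt vanishes on negatives: if a22 <= 0, one critical parameter makes
   the whole interval critical, against uniqueness. *)
rewrite (ler0_sqrtr a22_le0) mulr0 mul0r => /esym/eqP.
rewrite mulf_eq0 [_ == 0 :> R in X in _ || X]gt_eqF ?sqrtr_gt0 ?subr_gt0 // orbF.
move=> /eqP ca12.
(* The midpoint of [t] and [a11] is a second critical parameter: both sides of the critical equation
   vanish there. *)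
have ctc' : c ^+ 2 / (4 * a21) < (t + a11) / 2 < a11 by apply/andP; split; lra.
have /uniq_t : critical_param a11 a12 a21 a22 c ((t + a11) / 2).
  by apply/critical_paramE => //; rewrite ca12 (ler0_sqrtr a22_le0) mulr0 !mul0r.
lra.
Qed.

(** * The bound on g from nonnegativity *)

Lemma psd_gfun_ge (R : realType) (a11 a12 a21 a22 b c t : R) :
  0 < a21 -> 0 < a12 -> 0 < a22 -> critical_param a11 a12 a21 a22 c t ->
  psd (biquad a11 a12 a21 a22 b c) -> `|b| / 2 <= gfun a11 a12 a21 a22 c t.
Proof.
move=> a21_gt0 a12_gt0 a22_gt0 crit f_psd.
have [ctc _] := crit; have /andP[ct ta] := ctc.
have [t_gt0 s_gt0] := slack_gt0 a21_gt0 ct.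
have P_gt0 : 0 < a11 - t by rewrite subr_gt0.
have := (critical_paramE a12 a22 a21_gt0 ctc).1 crit.
rewrite /gfun; set u := Num.sqrt ((a11 - t) * a22); set v := Num.sqrt (a12 * _).
move=> critE.
have uE : u ^+ 2 = (a11 - t) * a22 by rewrite sqr_sqrtr // ltW // mulr_gt0.
have vE : v ^+ 2 = a12 * (a21 - c ^+ 2 / (4 * t)).
  by rewrite sqr_sqrtr // ltW // mulr_gt0.
have u_gt0 : 0 < u by rewrite sqrtr_gt0 mulr_gt0.
have v_gt0 : 0 < v by rewrite sqrtr_gt0 mulr_gt0.
(* This is the critical equation multiplied by the square roots of [a12] and [a22]. *)
have uvE : 4 * t ^+ 2 * a22 * v = a12 * c ^+ 2 * u.
  rewrite /u /v !sqrtrM ?ltW //.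
  have := sqr_sqrtr (ltW a22_gt0); have := sqr_sqrtr (ltW a12_gt0).
  move: critE; set p := Num.sqrt a12; set q := Num.sqrt a22.
  set x := Num.sqrt (a11 - t); set y := Num.sqrt (a21 - _) => critE <- <-.
  transitivity (p * q * (4 * t ^+ 2 * q * y)); first by ring.
  by rewrite critE; ring.
have c2_gt0 : 0 < c ^+ 2.
  have : 0 < a12 * c ^+ 2 * u by rewrite -uvE !mulr_gt0 ?exprn_gt0.
  by rewrite pmulr_lgt0 // pmulr_rgt0.
(* The choice x = (c, 2t) kills [x1 - c / (2 * t) * x2]. Then [y1] and [y2] are chosen so that the
   first binary form with beta = 2 sgn b vanishes; by [uvE] the second vanishes too. *)
have := f_psd (fun i : 'I_4 =>
  nth 0 [:: c; 2 * t; 2 * t * a22; Num.sg b * (c * u)] i).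
rewrite meval_biquad.
(* For [b = 0] the sign in the point degenerates to 0, but the bound is immediate from g(t) > 0. *)
have [->|b0] := eqVneq b 0; first by move=> _; rewrite normr0 mul0r ltW // addr_gt0.
have sE : Num.sg b ^+ 2 = 1 by rewrite sqr_sg b0.
have bE : b = Num.sg b * `|b| by exact: numEsg.
set e := Num.sg b in sE bE *.
have -> : a11 * (c ^+ 2 * (2 * t * a22) ^+ 2)
    + a22 * ((2 * t) ^+ 2 * (e * (c * u)) ^+ 2)
    + a12 * (c ^+ 2 * (e * (c * u)) ^+ 2)
    + a21 * ((2 * t) ^+ 2 * (2 * t * a22) ^+ 2)
    - b * (c * (2 * t * a22) * (2 * t) * (e * (c * u)))
    - c * (c * (2 * t) * (2 * t * a22) ^+ 2) =
    8 * t ^+ 2 * c ^+ 2 * a22 * u * (u + v - `|b| / 2).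
  (* Up to the factor [a12], both sides are [v ^+ 2 * (4 * t ^+ 2 * a22) ^+ 2], computed once by
     [uvE] and once by [vE]. This trades the term in [a21] for one in [v]. *)
  have sqE : c ^+ 2 * u * (4 * t ^+ 2 * a22 * v) =
      (4 * t * a21 - c ^+ 2) * 4 * t ^+ 3 * a22 ^+ 2.
    apply: (mulfI (lt0r_neq0 a12_gt0)).
    transitivity (v ^+ 2 * (4 * t ^+ 2 * a22) ^+ 2).
      transitivity (a12 * c ^+ 2 * u * (4 * t ^+ 2 * a22 * v)); first by ring.
      by rewrite -uvE; ring.
    by rewrite vE; field; rewrite gt_eqF.
  have -> : b * (c * (2 * t * a22) * (2 * t) * (e * (c * u))) =
      (e * b) * (4 * t ^+ 2 * c ^+ 2 * a22 * u) by ring.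
  have -> : e * b = `|b| by rewrite {1}bE mulrA -expr2 sE mul1r.
  rewrite !exprMn sE mul1r.
  transitivity (4 * t ^+ 2 * c ^+ 2 * a22 * ((a11 - t) * a22 + u ^+ 2)
    + a12 * c ^+ 2 * u * (c ^+ 2 * u)
    + (4 * t * a21 - c ^+ 2) * 4 * t ^+ 3 * a22 ^+ 2
    - `|b| * (4 * t ^+ 2 * c ^+ 2 * a22 * u)); first by ring.
  rewrite -uE -sqE -uvE; by field.
rewrite pmulr_rge0 ?subr_ge0 //.
by do 3 rewrite mulr_gt0 //; rewrite mulr_gt0 ?exprn_gt0.
Qed.

(** * The sum of squares from the bound on g *)

Lemma gfun_ge_sos (R : realType) (a11 a12 a21 a22 b c t : R) :
  0 < a21 -> 0 < a12 -> 0 < a22 -> c ^+ 2 / (4 * a21) < t < a11 ->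
  `|b| / 2 <= gfun a11 a12 a21 a22 c t -> sos (biquad a11 a12 a21 a22 b c).
Proof.
move=> a21_gt0 a12_gt0 a22_gt0 /andP[ct ta].
have [t_gt0 s_gt0] := slack_gt0 a21_gt0 ct.
have P_gt0 : 0 < a11 - t by rewrite subr_gt0.
rewrite /gfun; set u := Num.sqrt ((a11 - t) * a22); set v := Num.sqrt (a12 * _).
move=> b_le.
have uE : u ^+ 2 = (a11 - t) * a22 by rewrite sqr_sqrtr // ltW // mulr_gt0.
have vE : v ^+ 2 = a12 * (a21 - c ^+ 2 / (4 * t)).
  by rewrite sqr_sqrtr // ltW // mulr_gt0.
have u_gt0 : 0 < u by rewrite sqrtr_gt0 mulr_gt0.
have v_gt0 : 0 < v by rewrite sqrtr_gt0 mulr_gt0.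
have uv_gt0 : 0 < u + v by rewrite addr_gt0.
have beta_le : (b / (u + v)) ^+ 2 <= 4.
  have -> : (4 : R) = 2 ^+ 2 by rewrite -natrX.
  rewrite -real_normK ?num_real // ler_pXn2r ?nnegrE // normrM normfV.
  by rewrite (gtr0_norm uv_gt0) ler_pdivrMr // mulrC -ler_pdivrMr.
set beta := b / (u + v) in beta_le.
have bE : b = beta * u + beta * v by rewrite -mulrDr divfK // gt_eqF.
rewrite /biquad; set x1 := mvar R (inord 0 : 'I_4).
set x2 := mvar R (inord 1 : 'I_4); set y1 := mvar R (inord 2 : 'I_4).
set y2 := mvar R (inord 3 : 'I_4).
(* The square [t (x1 - k x2)^2 y1^2] absorbs the whole [c] term; it takes [t] from [a11] and
   [t * k ^+ 2] from [a21], leaving [P] and [s]. *)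
set k := c / (2 * t).
have kt2 : t * k ^+ 2 = c ^+ 2 / (4 * t) by rewrite /k; field; lra.
have ktE : c = 2 * (t * k) by rewrite /k; field; lra.
pose s := a21 - c ^+ 2 / (4 * t).
have a21E : a21 = s + t * k ^+ 2 by rewrite kt2 /s subrK.
have a11E : a11 = (a11 - t) + t by rewrite subrK.
set P := a11 - t in a11E uE P_gt0.
have -> : a11 *: (x1 ^+ 2 * y1 ^+ 2) + a22 *: (x2 ^+ 2 * y2 ^+ 2)
    + a12 *: (x1 ^+ 2 * y2 ^+ 2) + a21 *: (x2 ^+ 2 * y1 ^+ 2)
    - b *: (x1 * y1 * x2 * y2) - c *: (x1 * x2 * y1 ^+ 2) =
  (P *: (x1 * y1) ^+ 2 + a22 *: (x2 * y2) ^+ 2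
     - (beta * u) *: ((x1 * y1) * (x2 * y2)))
  + (a12 *: (x1 * y2) ^+ 2 + s *: (x2 * y1) ^+ 2
     - (beta * v) *: ((x1 * y2) * (x2 * y1)))
  + t *: ((x1 - k *: x2) * y1) ^+ 2.
  rewrite [in LHS]a21E [in LHS]a11E [in LHS]bE [in LHS]ktE.
  clearbody P s k u v beta x1 x2 y1 y2.
  rewrite -!mul_mpolyC !expr2 !(mpolyCD, mpolyCM, mpolyC_nat); ring.
apply: sosD; last by apply: sosZ_sqr; exact: ltW.
(* Since [u ^+ 2 = P * a22] and [v ^+ 2 = a12 * s], both discriminant bounds reduce to
   [beta ^+ 2 <= 4]. *)
apply: sosD; apply: sos_binary_form => //; rewrite exprMn.
  by rewrite uE -[leRHS]mulrA ler_wpM2r // ltW // mulr_gt0.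
by rewrite vE -[leRHS]mulrA ler_wpM2r // ltW // mulr_gt0.
Qed.

Theorem theorem4p7 (R : realType) (a11 a12 a21 a22 b cy1 a112s : R)
    (ha21 : 0 < a21)
    (ha112s : unique (critical_param a11 a12 a21 a22 cy1) a112s) :
  [<-> psd (biquad a11 a12 a21 a22 b cy1);
       sos (biquad a11 a12 a21 a22 b cy1);
       `|b| / 2 <= gfun a11 a12 a21 a22 cy1 a112s].
Proof.
have [a12_gt0 a22_gt0] := unique_critical_gt0 ha21 ha112s.
have [crit _] := ha112s; have [ctc _] := crit.
have psd_c := psd_gfun_ge ha21 a12_gt0 a22_gt0 crit.
have c_sos := gfun_ge_sos ha21 a12_gt0 a22_gt0 ctc.
tfae=> [/psd_c/c_sos|/sos_psd/psd_c|/c_sos/sos_psd] //.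
Qed.
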